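(* Assume $\mathrm{add}(\mathcal N)=\mathfrak c$. Then for every $\mathcal I\in\{\mathcal N,\mathcal M,\mathcal K\}$ and every $R\in\{\in^*,\leq^*,\neq^*\}$ we have $\mathfrak b(R_{\mathcal I})\ge\mathfrak c^+$ and $\mathfrak d(R_{\mathcal I})\ge\mathfrak c^+$.
   Context: $\mathfrak c=2^{\aleph_0}$. $\omega^\omega$ is Baire space with Lebesgue measure $\mu$: the (completed) Borel measure with $\mu(N_s)=\prod_{i<\mathrm{length}(s)}2^{-(s(i)+1)}$ for $s\in\omega^{<\omega}$, where $N_s=\{x\in\omega^\omega: s\subseteq x\}$. $\mathcal N$ is the ideal of $\mu$-null subsets of $\omega^\omega$, $\mathcal M$ the ideal of meager subsets of $\omega^\omega$, and $\mathcal K$ the ideal of subsets of $\omega^\omega$ contained in a $\sigma$-compact set. $\mathrm{add}(\mathcal N)$ is the least size of a family of null sets whose union is not null. A slalom is a function $s:\omega\to[\omega]^{<\omega}$ with $|s(n)|\le n$ for all $n$; $\mathcal S$ is the set of slaloms. For $x,y\in\omega^\omega$ and $s\in\mathcal S$: $x\leq^* y$ iff $x(n)\le y(n)$ for all but finitely many $n$; $x\neq^* y$ iff $x(n)\ne y(n)$ for all but finitely many $n$; $x\in^* s$ iff $x(n)\in s(n)$ for all but finitely many $n$. For $\mathcal I\in\{\mathcal N,\mathcal M,\mathcal K\}$, $R\in\{\leq^*,\neq^*,\in^*\}$, $f:\omega^\omega\to\omega^\omega$ and $g:\omega^\omega\to\omega^\omega$ ($g:\omega^\omega\to\mathcal S$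 if $R$ is $\in^*$), write $f R_{\mathcal I} g$ iff $\{x\in\omega^\omega:\neg\, f(x) R g(x)\}\in\mathcal I$. Then $\mathfrak b(R_{\mathcal I})$ is the least size of a set $A$ of functions $\omega^\omega\to\omega^\omega$ for which there is no $g:\omega^\omega\to\omega^\omega$ (no $g:\omega^\omega\to\mathcal S$ if $R$ is $\in^*$) with $f R_{\mathcal I} g$ for all $f\in A$; and $\mathfrak d(R_{\mathcal I})$ is the least size of a set $A$ of functions $\omega^\omega\to\omega^\omega$ (functions $\omega^\omega\to\mathcal S$ if $R$ is $\in^*$) such that for every $g:\omega^\omega\to\omega^\omega$ there is $f\in A$ with $g R_{\mathcal I} f$. *)

(* Defs.v *)
From mathcomp Require Import all_boot all_order all_algebra.
From mathcomp Require Import finmap.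
From mathcomp Require Import all_classical all_reals.
From mathcomp Require Import topology sequences measure.

Set Implicit Arguments.
Unset Strict Implicit.
Unset Printing Implicit Defensive.

Import Order.TTheory GRing.Theory Num.Theory.

Local Open Scope classical_set_scope.
Local Open Scope ring_scope.
Local Open Scope card_scope.

(* The least size of a member of P. A cardinal is represented by a set of that
   size. The default value set0 only occurs when P is empty, see least_cardP;
   sizes are compared by #<= and #=, so the witness chosen does not matter. *)
Definition least_card (T : Type) (P : set (set T)) : set T :=
  xget set0 [set A | P A /\ forall B, P B -> A #<= B].

Lemma least_cardP (T : Type) (P : set (set T)) : P !=set0 ->
  P (least_card P) /\ forall B, P B -> least_card P #<= B.
Proof.
move=> [A0 PA0]; apply: (@xgetPex _ set0 [set A | P A /\ _]).
pose sel := [set S : set (set T -> option T) |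
  (forall f, S f -> forall A, P A -> exists2 a, A a & f A = Some a) /\
  (forall f g A, S f -> S g -> P A -> f A = g A -> f = g)].
have [|S [[Sin Sinj] Smax]] := @Zorn_bigcup _ sel.
  move=> F Fsel Ftot; split=> [f [S FS Sf]|f g A [S FS Sf] [S' FS' Sg] PA].
    by have [+ _] := Fsel _ FS; apply.
  have [SS'|S'S] := Ftot _ _ FS FS'.
    by have [_ /(_ f g A)] := Fsel _ FS'; apply=> //; exact: SS'.
  by have [_ /(_ f g A)] := Fsel _ FS; apply=> //; exact: S'S.
have [A PA hit] : exists2 A, P A &
    forall a, A a -> exists2 f, S f & f A = Some a.
  apply: contrapT => nohit.
  have /choice[h hP] : forall A, exists o : option T, P A ->
      exists a, [/\ A a, o = Some a & forall f, S f -> f A <> Some a].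
    move=> A; have [PA|nPA] := pselect (P A); last by exists None.
    apply: contrapT => nex; apply: nohit; exists A => // a Aa.
    apply: contrapT => nf; apply: nex; exists (Some a) => _; exists a.
    by split=> // f Sf fA; apply: nf; exists f.
  have Sh : ~ S h.
    by move=> Sh; have [a [_ ha /(_ _ Sh)]] := hP _ PA0.
  apply: (Smax (S `|` [set h])).
    split; first by move=> f Sf; left.
    by move=> /(_ h (or_intror erefl)).
  split=> [f [Sf|->] A PA|f g A [Sf|->] [Sg|->] PA //].
  - exact: Sin.
  - by have [a [Aa ha _]] := hP _ PA; exists a.
  - exact: Sinj.
  - by have [a [_ -> nf]] := hP _ PA => /(nf _ Sf).
  - by have [a [_ -> nf]] := hP _ PA => /esym /(nf _ Sg).
exists A; split=> // B PB.
have /choice[F FP] : forall a, exists f, A a -> S f /\ f A = Some a.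
  move=> a; have [Aa|] := pselect (A a); last by exists (fun=> None).
  by have [f Sf fA] := hit _ Aa; exists f.
have /choice[b bP] : forall a, exists b, A a -> B b /\ F a B = Some b.
  move=> a; have [Aa|] := pselect (A a); last by exists a.
  by have [Sf _] := FP _ Aa; have [b Bb fB] := Sin _ Sf _ PB; exists b.
suff /injfunPex[f] : exists2 b : T -> T, set_fun A B b & set_inj A b.
  exact: inj_card_le f.
exists b; first by move=> a /bP[].
move=> a a' /set_mem Aa /set_mem Aa' baa'.
have [[Sa Fa] [Sa' Fa']] := (FP _ Aa, FP _ Aa').
have eF : F a = F a'.
  by apply: (Sinj _ _ B) => //; rewrite (bP _ Aa).2 (bP _ Aa').2 baa'.
by have := Fa; rewrite eF Fa' => -[].
Qed.

Definition continuum : set (set nat) := [set: set nat].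

(* kappa^+ is realised among the sets of subsets of the carrier of kappa, which
   include sets of size 2^T > kappa. *)
Definition succ_card (T : Type) (kappa : set T) : set (set T) :=
  least_card [set A : set (set T) | ~ (A #<= kappa)].

(* nat is discrete and {ptws _ -> _} carries the product topology. *)
Definition baire := {ptws nat -> nat}.

Definition cylinder (s : seq nat) : set baire :=
  [set x | forall i, (i < size s)%N -> x i = nth 0%N s i].

Definition borel_baire := g_sigma_algebraType (@open baire).

(* By the pi-lambda theorem at most one Borel measure satisfies this. *)
Definition lebesgue_baire (R : realType)
    (mu : {measure set borel_baire -> \bar R}) : Prop :=
  forall s : seq nat,
    mu (cylinder s) = (\prod_(i < size s) 2^-1 ^+ (nth 0%N s i).+1)%:E.

(* mu.-negligible sets, i.e., subsets of Borel sets of measure zero, are exactly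
   the null sets of the completion of mu. *)
Definition null_ideal (R : realType)
    (mu : {measure set borel_baire -> \bar R}) : set (set baire) :=
  [set A : set baire | mu.-negligible A].

Definition nowhere_dense (A : set baire) : Prop := interior (closure A) = set0.

Definition meager_ideal : set (set baire) :=
  [set A | exists2 F : (set baire)^nat,
    (forall n, nowhere_dense (F n)) & A = \bigcup_n F n].

Definition sigma_compact_ideal : set (set baire) :=
  [set A | exists2 F : (set baire)^nat,
    (forall n, compact (F n)) & A `<=` \bigcup_n F n].

Definition add_card (I : set (set baire)) : set (set baire) :=
  least_card [set F : set (set baire) | F `<=` I /\ ~ I (\bigcup_(A in F) A)].

Inductive ideal_name := Null | Meager | SigmaCompact.

Definition ideal (R : realType) (mu : {measure set borel_baire -> \bar R})
    (i : ideal_name) : set (set baire) :=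
  match i with
  | Null => null_ideal mu
  | Meager => meager_ideal
  | SigmaCompact => sigma_compact_ideal
  end.

Definition slalom := {s : nat -> {fset nat} | forall n, (#|` s n| <= n)%N}.

Definition le_star (x y : baire) : Prop := \forall n \near \oo, (x n <= y n)%N.
Definition ne_star (x y : baire) : Prop := \forall n \near \oo, x n <> y n.
Definition in_star (x : baire) (s : slalom) : Prop :=
  \forall n \near \oo, x n \in sval s n.

Inductive rel_name := InStar | LeStar | NeStar.

Definition target (r : rel_name) : Type :=
  match r with InStar => slalom | LeStar => baire | NeStar => baire end.

Definition star (r : rel_name) : baire -> target r -> Prop :=
  match r return baire -> target r -> Prop with
  | InStar => in_star
  | LeStar => le_star
  | NeStar => ne_star
  end.

Definition rel_mod (Y : Type) (Rel : baire -> Y -> Prop) (I : set (set baire))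
    (f : baire -> baire) (g : baire -> Y) : Prop :=
  I [set x | ~ Rel (f x) (g x)].

Definition b_card (Y : Type) (Rel : baire -> Y -> Prop) (I : set (set baire)) :
    set (baire -> baire) :=
  least_card [set A : set (baire -> baire) |
    ~ exists g : baire -> Y, forall f, A f -> rel_mod Rel I f g].

Definition d_card (Y : Type) (Rel : baire -> Y -> Prop) (I : set (set baire)) :
    set (baire -> Y) :=
  least_card [set A : set (baire -> Y) |
    forall g : baire -> baire, exists2 f, A f & rel_mod Rel I g f].

(* Main.v *)
(** Under [add(N) = c], Bartoszynski's argument captures any fewer than [c] reals
    in a single slalom. To [f] one attaches the null set of all [x] taking the
    value [n] at coordinate [<n, f n>] for infinitely many [n]; a closed set [K] of
    positive measure avoiding all these null sets yields, for each basic open [U]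
    with [K `&` U] of positive measure, the sets
    [{k | K `&` U meets x <n, k> = n in measure 0}], which are finite of bounded
    size by independence, and each [f] is captured by one of these countably many
    families. Consequently fewer than [c] reals are bounded for each of the three
    relations, fewer than [c] targets can be evaded by one real, and sets of size
    less than [c] lie in all three ideals.

    Given [c] functions [f], enumerate them and the points of Baire space in type
    [c] and choose [g x] to bound (resp. evade) [f x] for all [f] enumerated before
    [x]. For each [f] only fewer than [c] points [x] go wrong; for the second
    cardinal one also uses that the ideals are proper. *)
Require Import Defs.
From mathcomp Require Import all_boot all_order all_algebra.
From mathcomp Require Import finmap.
From mathcomp Require Import wochoice.
From mathcomp Require Import all_classical all_reals.
From mathcomp Require Import topology ereal normedtype sequences measure.

Set Implicit Arguments.
Unset Strict Implicit.
Unset Printing Implicit Defensive.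

Import Order.TTheory GRing.Theory Num.Theory.

Local Open Scope classical_set_scope.
Local Open Scope ring_scope.
Local Open Scope card_scope.

(** * Cardinals *)

Lemma set_inj_card_le (T U : Type) (A : set T) (B : set U) (f : T -> U) :
  set_fun A B f -> set_inj A f -> A #<= B.
Proof.
move=> fAB finj.
have /injfunPex[g] : exists2 g : T -> U, set_fun A B g & set_inj A g by exists f.
exact: inj_card_le g.
Qed.

Lemma card_le_set_inj (T : Type) (U : pointedType) (A : set T) (B : set U) :
  A #<= B -> exists2 f : T -> U, set_fun A B f & set_inj A f.
Proof. by move=> /pcard_leP/injfunPex. Qed.

(** Copies of [A] and [B] inside the sum type form a two-element family; whichever copy is its least
    member embeds in the other. *)
Lemma card_le_total (T U : Type) (A : set T) (B : set U) :
  A #<= B \/ B #<= A.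
Proof.
have inlA : (@inl T U) @` A #= A by apply: inj_card_eq => ? ? _ _ [].
have inrB : (@inr T U) @` B #= B by apply: inj_card_eq => ? ? _ _ [].
have [|+ Lmin] := @least_cardP _ [set (@inl T U) @` A; (@inr T U) @` B].
  by exists (inl @` A); left.
have [LA LB] := (Lmin _ (or_introl erefl), Lmin _ (or_intror erefl)).
move=> [LE|LE]; [left|right].
  by move: LB; rewrite LE (card_le_eql inlA) (card_le_eqr inrB).
by move: LA; rewrite LE (card_le_eql inrB) (card_le_eqr inlA).
Qed.

Lemma Cantor_continuum : ~ ([set: set (set nat)] #<= continuum).
Proof.
move=> /card_le_set_inj[f _ finj].
pose D := [set X | exists2 Y, f Y = X & ~ Y X].
have nDf : ~ D (f D).
  move=> Df; have := Df; move=> [Y fY].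
  by have -> : Y = D by apply: finj; rewrite ?inE.
by apply: (nDf); exists D.
Qed.

(** If instead [A] embeds in [succ_card continuum], its image there competes in the minimum that
    defines [succ_card continuum]. *)
Lemma succ_continuum_le (T : Type) (A : set T) :
  ~ (A #<= continuum) -> succ_card continuum #<= A.
Proof.
move=> AnC.
have [|_ Smin] := @least_cardP _ [set A : set (set (set nat)) | ~ (A #<= continuum)].
  by exists setT; exact: Cantor_continuum.
have [//|/card_le_set_inj[f _ finj]] := card_le_total (succ_card continuum) A.
have fA : f @` A #= A by exact: inj_card_eq.
rewrite -(card_le_eqr fA); apply: Smin => /=.
by rewrite (card_le_eql fA).
Qed.

(** By comparability of cardinals the negation means size strictly below the continuum. *)
Definition small (T : Type) (A : set T) : Prop := ~ (continuum #<= A).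

Lemma small_le (T U : Type) (A : set T) (B : set U) :
  A #<= B -> small B -> small A.
Proof. by move=> AB sB CA; apply: sB; exact: card_le_trans AB. Qed.

Lemma small_sub (T : Type) (A B : set T) : A `<=` B -> small B -> small A.
Proof. by move=> /subset_card_le; exact: small_le. Qed.

Lemma small_image (T U : Type) (f : T -> U) (A : set T) :
  small A -> small (f @` A).
Proof. exact/small_le/card_image_le. Qed.

(** Prefixing a bit to the subsets of [nat] gives two disjoint copies of the power set; an injection
    takes the value [a] on at most one of them. *)
Lemma continuum_le_setD1 (T : pointedType) (A : set T) (a : T) :
  continuum #<= A -> continuum #<= A `\ a.
Proof.
move=> /card_le_set_inj[f fA finj].
pose j (P : Prop) (X : set nat) : set nat :=
  [set k | if k is m.+1 then X m else P].
have jinj P : injective (j P).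
  by move=> X Y jXY; apply/funext => m; have := congr1 (@^~ m.+1) jXY.
have jTF X Y : j True X <> j False Y.
  by move=> jXY; have := congr1 (@^~ 0%N) jXY => /= TF; rewrite -TF.
have [P nja] : exists P, forall X, f (j P X) <> a.
  have [[X fX]|nX] := pselect (exists X, f (j True X) = a).
    exists False => Y fY; apply: (jTF X Y).
    by apply: finj; rewrite ?inE// fX fY.
  by exists True => X fX; apply: nX; exists X.
apply: (@set_inj_card_le _ _ _ _ (f \o j P)) => [X _|X Y _ _ /= fXY].
  by split; [exact: fA|exact: nja].
by apply: (@jinj P); apply: finj; rewrite ?inE.
Qed.

(* A well-order of the continuum all of whose closed initial segments are
   small, cut off below the first large one if there is any. *)
Lemma continuum_small_initial_segments :
  exists W : set nat -> set nat -> Prop,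
    (forall X, small [set Y | W X Y]) /\ (forall Y, small [set X | ~ W X Y]).
Proof.
have [R Rwo] := well_ordering_principle (set nat : choiceType).
have Rmin (A : set (set nat)) : A !=set0 ->
    exists2 z, A z & forall x, A x -> R z x.
  move=> [x Ax]; have [|z [[Az zlb] _]] := Rwo (mem A); first by exists x; apply/mem_set.
  by exists z => [|y Ay]; [exact/set_mem|apply: zlb; exact/mem_set].
have Rtot x y : R x y \/ R y x.
  have [|z zE zlb] := Rmin [set x; y]; first by exists x; left.
  by move: zlb; case: zE => -> zlb; [left|right]; apply: zlb; [right|left].
have Ranti x y : R x y -> R y x -> x = y.
  move=> Rxy Ryx.
  have [|z [_ zuniq]] := Rwo (mem [set x; y]).
    by exists x; apply/mem_set; left.
  have Rrefl w : R w w by case: (Rtot w w).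
  have mx : minimum_of R (mem [set x; y]) x.
    by split; [apply/mem_set; left|move=> w /set_mem[]->].
  have my : minimum_of R (mem [set x; y]) y.
    by split; [apply/mem_set; right|move=> w /set_mem[]->].
  by rewrite -(zuniq _ mx) -(zuniq _ my).
have [h hinj hsmall] : exists2 h : set nat -> set nat, injective h &
    forall x, small [set z | R z (h x)].
  have [[t0 t0P]|nlarge] := pselect (exists t, continuum #<= [set z | R z t]);
    last first.
    by exists id => // x large; apply: nlarge; exists x.
  have [|t tlarge tmin] := Rmin [set t | continuum #<= [set z | R z t]].
    by exists t0.
  have /card_le_set_inj[h hR hinj] := continuum_le_setD1 t tlarge.
  exists h => [x y|x large]; first by apply: hinj; rewrite inE.
  have [Rht] := hR x I; apply; apply: Ranti => //.
  exact: tmin.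
(* This relation says that [h y] strictly precedes [h x], so [h] embeds both kinds of sections in
   the small segments of [hsmall]. *)
exists (fun x y => ~ R (h x) (h y)); split=> [x|y].
  apply: small_le (hsmall x).
  apply: (@set_inj_card_le _ _ _ _ h) => [y /= nR|? ? _ _]; last exact: hinj.
  by have [] := Rtot (h x) (h y).
apply: small_le (hsmall y).
apply: (@set_inj_card_le _ _ _ _ h) => [x /= /contrapT//|? ? _ _].
exact: hinj.
Qed.

(** The bookkeeping for the transfinite construction: with [A] and [B] injected into one well-order,
    [W a b] says that [b] comes before [a]. *)
Lemma small_sections (T U : Type) (A : set T) (B : set U) :
  A #<= continuum -> B #<= continuum ->
  exists W : T -> U -> Prop, (forall a, small [set b | B b /\ W a b]) /\
    (forall b, small [set a | A a /\ ~ W a b]).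
Proof.
move=> /card_le_set_inj[i _ iinj] /card_le_set_inj[j _ jinj].
have [W [W1 W2]] := continuum_small_initial_segments.
exists (fun a b => W (i a) (j b)); split=> [a|b].
  apply: small_le (W1 (i a)); apply: (@set_inj_card_le _ _ _ _ j) => [b []//|].
  by move=> b b' /set_mem[? _] /set_mem[? _]; apply: jinj; rewrite inE.
apply: small_le (W2 (j b)); apply: (@set_inj_card_le _ _ _ _ i) => [a []//|].
by move=> a a' /set_mem[? _] /set_mem[? _]; apply: iinj; rewrite inE.
Qed.

Lemma baire_le_continuum : [set: baire] #<= continuum.
Proof.
pose graph (x : baire) : set nat := [set k | exists n, k = choice.pickle (n, x n)].
apply: (@set_inj_card_le _ _ _ _ graph) => [//|x y _ _ xy]; apply/funext => n.
have /= := congr1 (@^~ (choice.pickle (n, x n))) xy.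
move=> e; have [m] : graph y (choice.pickle (n, x n)) by rewrite -e; exists n.
by move=> /(pcan_inj choice.pickleK)[<- ->].
Qed.

(** * Topology of Baire space *)

Lemma open_coord (i : nat) (P : set nat) : open [set x : baire | P (x i)].
Proof.
apply: (@open_comp baire nat (fun x => x i)); last exact: discrete_open.
by move=> x _; exact: (@proj_continuous nat (fun=> nat) i).
Qed.

Lemma closed_coord (i : nat) (P : set nat) : closed [set x : baire | P (x i)].
Proof. by rewrite -openC; exact: (open_coord i (~` P)). Qed.

Lemma cylinder_nil : cylinder [::] = setT.
Proof. by apply/seteqP. Qed.

Lemma cylinder_rcons (s : seq nat) (a : nat) :
  cylinder (rcons s a) = cylinder s `&` [set x | x (size s) = a].
Proof.
apply/seteqP; split=> [x sx|x [sx xa] i].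
  split=> [i si|]; have := sx _; rewrite size_rcons.
    by move=> /(_ i); rewrite nth_rcons si; apply; exact: ltnW.
  by move=> /(_ _ (leqnn _)); rewrite nth_rcons ltnn eqxx.
rewrite size_rcons ltnS leq_eqVlt nth_rcons => /predU1P[->|si].
  by rewrite ltnn eqxx.
by rewrite si sx.
Qed.

Lemma open_cylinder (s : seq nat) : open (cylinder s).
Proof.
elim/last_ind: s => [|s a IH]; first by rewrite cylinder_nil; exact: openT.
by rewrite cylinder_rcons; apply: openI => //; exact: (open_coord _ [set a]).
Qed.

Lemma closed_cylinder (s : seq nat) : closed (cylinder s).
Proof.
elim/last_ind: s => [|s a IH]; first by rewrite cylinder_nil; exact: closedT.
rewrite cylinder_rcons; apply: closedI => [|]; [exact: IH|].
exact: (@closed_coord (size s) [set a]).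
Qed.

Lemma cylinder_mkseq (x y : baire) (n : nat) :
  cylinder (mkseq x n) y <-> forall i, (i < n)%N -> y i = x i.
Proof.
rewrite /cylinder /= size_mkseq; split=> h i ni; have := h i ni;
by rewrite nth_mkseq.
Qed.

Lemma cylinder_mkseqP (s : seq nat) (x : baire) :
  cylinder s x <-> mkseq x (size s) = s.
Proof.
split=> [sx|<-]; last by apply/cylinder_mkseq.
apply: (@eq_from_nth _ 0%N); rewrite size_mkseq// => i si.
by rewrite nth_mkseq// sx.
Qed.

(** Otherwise points [y n] outside [U] that agree with [x] below [n] converge to [x] in each
    coordinate, hence in the product topology. *)
Lemma nbhs_cylinder (x : baire) (U : set baire) :
  nbhs x U -> exists n, cylinder (mkseq x n) `<=` U.
Proof.
move=> xU; apply: contrapT => nU.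
have /choice[y yP] : forall n, exists y, cylinder (mkseq x n) y /\ ~ U y.
  move=> n; apply: contrapT => ny; apply: nU; exists n => y xy.
  by apply: contrapT => nUy; apply: ny; exists y.
have : y @ \oo --> x.
  apply/cvg_sup => N V [_ [[W oW <-] WxN WV]].
  apply: (filterS WV); exists N.+1 => // n /= Nn.
  have [/cylinder_mkseq yx _] := yP n.
  by rewrite /= yx.
move=> /(_ _ xU)[n _ /(_ n (leqnn n))].
by have [] := yP n.
Qed.

Lemma open_cylinderP (U : set baire) :
  open U <-> forall x, U x -> exists n, cylinder (mkseq x n) `<=` U.
Proof.
split=> [oU x Ux|h]; first by apply: nbhs_cylinder; exact: open_nbhs_nbhs.
rewrite openE => x /h[n xU]; apply: (filterS xU).
by apply: open_nbhs_nbhs; split; [exact: open_cylinder|apply/cylinder_mkseq].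
Qed.

(** The construction behind the Baire category theorem: extend [s0] inside [G], meeting requirement
    [Q k] at step [k]; nonempty extensions make the limit total. [G] is a parameter so that it can
    also consist of the [s] whose cylinder meets a closed set in positive measure. *)
Lemma generic_branch (G : set (seq nat)) (Q : nat -> set (seq nat)) s0 :
  G s0 ->
  (forall k s, G s -> exists t, [/\ t != [::], G (s ++ t) & Q k (s ++ t)]) ->
  exists2 x : baire, cylinder s0 x &
    forall k, exists m, [/\ (k <= m)%N, G (mkseq x m) & Q k (mkseq x m)].
Proof.
move=> Gs0 step.
have /choice[F FP] : forall ks : nat * seq nat, exists t, G ks.2 ->
    [/\ t != [::], G (ks.2 ++ t) & Q ks.1 (ks.2 ++ t)].
  move=> [k s]; have [/(step k)[t tP]|nG] := pselect (G s); first by exists t.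
  by exists [::].
pose fix sq k := if k is k'.+1 then sq k' ++ F (k', sq k') else s0.
have Gsq k : G (sq k).
  by elim: k => [//|k /(FP (k, sq k))[]].
have Fsq k := FP (k, sq k) (Gsq k).
have size_sq k : (k <= size (sq k))%N.
  elim: k => //= k IH; have [Fn _ _] := Fsq k.
  by rewrite size_cat -addn1 leq_add// lt0n size_eq0.
have sq_prefix k d i : (i < size (sq k))%N ->
    nth 0%N (sq (d + k)%N) i = nth 0%N (sq k) i /\ (i < size (sq (d + k)%N))%N.
  move=> ik; elim: d => [//|d [IH1 IH2]].
  by rewrite /= nth_cat IH2 IH1 size_cat ltn_addr.
(* [sq i.+1] has length at least [i.+1], so the default of [nth] is never read. *)
pose x : baire := fun i => nth 0%N (sq i.+1) i.
have sqx k : cylinder (sq k) x.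
  move=> i ik; rewrite /x.
  have [ki|/ltnW ik'] := leqP k i.+1.
    by rewrite -(subnK ki); have [] := sq_prefix k (i.+1 - k)%N i ik.
  by rewrite -(subnK ik'); have [] := sq_prefix i.+1 (k - i.+1)%N i (size_sq _).
exists x; first exact: (sqx 0%N).
move=> k; exists (size (sq k.+1)); have /cylinder_mkseqP -> := sqx k.+1.
split; [exact: (leq_trans (leqnSn k) (size_sq k.+1))|exact: Gsq|].
by have [] := Fsq k.
Qed.

Lemma nowhere_dense_cylinder (A : set baire) (s : seq nat) : nowhere_dense A ->
  exists t, t != [::] /\ cylinder (s ++ t) `<=` ~` A.
Proof.
move=> ndA.
have [y sy nAy] : exists2 y, cylinder s y & ~ closure A y.
  apply: contrapT => ny.
  have [x sx] : cylinder s !=set0 by exists (nth 0%N s).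
  have : interior (closure A) x; last by rewrite ndA.
  apply: (@filterS _ _ _ (cylinder s)) => [y sy|].
    by apply: contrapT => nAy; apply: ny; exists y.
  by apply: open_nbhs_nbhs; split; [exact: open_cylinder|].
have oA : open (~` closure A) by rewrite openC; exact: closed_closure.
have [n nA] := (open_cylinderP (~` closure A)).1 oA _ nAy.
(* Long enough to enter the cylinder that misses [closure A], and longer than [s], so that the
   extension is proper. *)
pose m := (size s + n).+1.
have sE : s = take (size s) (mkseq y m).
  apply: (@eq_from_nth _ 0%N) => [|i si].
    by rewrite size_take size_mkseq ltnS leq_addr.
  by rewrite nth_take// nth_mkseq ?sy// (leq_trans si)// /m -addnS leq_addr.
exists (drop (size s) (mkseq y m)); split.
  by rewrite -size_eq0 size_drop size_mkseq subn_eq0 -ltnNge ltnS leq_addr.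
rewrite {1}sE cat_take_drop => x /cylinder_mkseq xy Ax.
apply: (nA x); last exact: subset_closure.
by apply/cylinder_mkseq => i ni; rewrite xy// ltnS ltnW// ltn_addl.
Qed.

Lemma baire_not_meager : ~ meager_ideal setT.
Proof.
move=> [F Fnd TF].
have [k s _|x _ xP] := @generic_branch setT
    (fun k => [set s | cylinder s `<=` ~` F k]) [::] I.
  by have [t [tn tF]] := nowhere_dense_cylinder s (Fnd k); exists t.
have [k _ Fkx] : (\bigcup_n F n) x by rewrite -TF.
have [m [_ _ mF]] := xP k; apply: (mF x) => //.
exact/cylinder_mkseq.
Qed.

Lemma le_compact (z : baire) : compact [set x : baire | forall i, (x i <= z i)%N].
Proof.
apply: (@tychonoff nat (fun=> nat) (fun i => [set k | (k <= z i)%N])) => i.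
by apply: finite_compact; exact: (finite_II (z i).+1).
Qed.

Lemma le_nowhere_dense (z : baire) :
  nowhere_dense [set x : baire | forall i, (x i <= z i)%N].
Proof.
rewrite /nowhere_dense -(closure_id _).1; last first.
  have -> : [set x : baire | forall i, (x i <= z i)%N] =
      \bigcap_i [set x : baire | (x i <= z i)%N].
    by apply/seteqP; split=> [x xz i _|x xz i]; [exact: xz|exact: (xz i I)].
  by apply: closed_bigI => i _; exact: (@closed_coord i [set k | (k <= z i)%N]).
rewrite -subset0 => x /nbhs_cylinder[n xz].
pose y : baire := fun i => if (i < n)%N then x i else (z i).+1.
have /xz/(_ n) : cylinder (mkseq x n) y by apply/cylinder_mkseq => i; rewrite /y => ->.
by rewrite /y ltnn ltnn.
Qed.

(** Near each point [x] every bound from [x i] on works locally; the near-covering form of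
    compactness makes one bound uniform. *)
Lemma compact_coord_bounded (K : set baire) (i : nat) : compact K ->
  exists N, forall x, K x -> (x i <= N)%N.
Proof.
move=> /compact_near_coveringP.
move=> /(_ nat \oo (fun N x => (x i <= N)%N) _).
case=> [x Kx|N _ KN]; last by exists N => x Kx; exact: (KN N (leqnn N)).

exists ([set y : baire | y i = x i], [set N | (x i <= N)%N]) => /=.
  split; last by exists (x i).
  by apply: open_nbhs_nbhs; split=> //; exact: (open_coord i [set x i]).
by move=> [y N] /= [-> ].
Qed.

(** * Independence of the coordinates *)

Lemma measurable_open_baire (A : set baire) :
  open A -> measurable (A : set borel_baire).
Proof. exact: sub_sigma_algebra. Qed.

Lemma measurable_closed_baire (A : set baire) :
  closed A -> measurable (A : set borel_baire).
Proof.
by rewrite -openC => /measurable_open_baire/measurableC; rewrite setCK.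
Qed.

Lemma measurable_cylinder (s : seq nat) :
  measurable (cylinder s : set borel_baire).
Proof. by apply: measurable_open_baire; exact: open_cylinder. Qed.

(** The cylinders of length [L] as a partition indexed by [nat], ready for countable additivity;
    indices that code no sequence of length [L] give the empty set. *)
Definition level (L k : nat) : set baire :=
  if choice.pickle_inv k is Some s then
    if size s == L then cylinder s else set0
  else set0.

Lemma level_pickle (s : seq nat) : level (size s) (choice.pickle s) = cylinder s.
Proof. by rewrite /level choice.pickleK_inv eqxx. Qed.

Lemma open_level (L k : nat) : open (level L k).
Proof.
rewrite /level; case: choice.pickle_inv => [s|]; last exact: open0.
by case: ifP => _; [exact: open_cylinder|exact: open0].
Qed.

Lemma measurable_level (L k : nat) : measurable (level L k : set borel_baire).
Proof. by apply: measurable_open_baire; exact: open_level. Qed.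

Lemma bigcup_level (L : nat) : \bigcup_k level L k = setT.
Proof.
apply/seteqP; split=> // x _; exists (choice.pickle (mkseq x L)) => //.
by rewrite -{1}(size_mkseq x L) level_pickle; exact/cylinder_mkseq.
Qed.

Lemma trivIset_level (L : nat) : trivIset setT (level L).
Proof.
have lvl i x : level L i x -> i = choice.pickle (mkseq x L).
  rewrite /level; have := @choice.pickle_invK (seq nat) i.
  case: choice.pickle_inv => [s /= <-|//]; case: eqP => // <-.
  by move=> /cylinder_mkseqP ->.
by move=> j k _ _ [x [/lvl -> /lvl ->]].
Qed.

Section lebesgue_measure_baire.
Context {R : realType} (mu : {measure set borel_baire -> \bar R})
  (hmu : lebesgue_baire mu).
Local Open Scope ereal_scope.

Lemma measure_level (L : nat) (A : set borel_baire) : measurable A ->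
  mu A = \sum_(k <oo) mu (A `&` level L k).
Proof.
move=> mA; rewrite -[in LHS](setIT A) -(bigcup_level L) setI_bigcupr.
rewrite measure_semi_bigcup//.
- by move=> k; apply: measurableI => //; exact: measurable_level.
- by apply: trivIset_setIl; exact: trivIset_level.
- apply: bigcup_measurable => k _.
  by apply: measurableI => //; exact: measurable_level.
Qed.

Lemma measure_level0 (L : nat) (A : set borel_baire) : measurable A ->
  (forall s, size s = L -> mu (A `&` cylinder s) = 0) -> mu A = 0.
Proof.
move=> mA A0; rewrite (measure_level L mA) eseries0// => k _ _.
rewrite /level; case: choice.pickle_inv => [s|]; last by rewrite setI0 measure0.
by case: eqP => [/A0//|_]; rewrite setI0 measure0.
Qed.

Lemma measure_cylinder_rcons (s : seq nat) (n : nat) :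
  mu (cylinder (rcons s n)) = (2^-1 ^+ n.+1)%:E * mu (cylinder s).
Proof.
rewrite !hmu -EFinM; congr EFin; rewrite size_rcons big_ord_recr/= mulrC.
rewrite nth_rcons ltnn eqxx; congr (_ * _)%R; apply: eq_bigr => i _.
by rewrite nth_rcons ltn_ord.
Qed.

Lemma measure_setT_baire : mu [set: borel_baire] = 1.
Proof. by have := hmu [::]; rewrite cylinder_nil big_ord0. Qed.

(** [A] is a union of cylinders of length [L], and appending the entry [n] multiplies the measure of
    each by $2^{-(n+1)}$. *)
Lemma measure_coord_indep (L n : nat) (A : set baire) :
  (forall x y : baire, A x -> (forall i, (i < L)%N -> y i = x i) -> A y) ->
  mu (A `&` [set x | x L = n]) = (2^-1 ^+ n.+1)%:E * mu A.
Proof.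
move=> Adet.
have oA : open A.
  apply/open_cylinderP => x Ax; exists L => y /cylinder_mkseq.
  exact: Adet.
have mA := measurable_open_baire oA.
rewrite (measure_level L mA) -nneseriesZl; last by move=> k _; exact: measure_ge0.
have mn : measurable ([set x : baire | x L = n] : set borel_baire).
  by apply: measurable_open_baire; exact: (open_coord L [set n]).
rewrite (measure_level L); last exact: measurableI.
apply: eq_eseriesr => k _.
rewrite /level; case: choice.pickle_inv => [s|]; last first.
  by rewrite !setI0 measure0 mule0.
case: eqP => [sL|_]; last by rewrite !setI0 measure0 mule0.
have [x0 sx0] : cylinder s !=set0 by exists (nth 0%N s).
have sA x y : cylinder s x -> cylinder s y -> A x -> A y.
  by move=> sx sy Ax; apply: (Adet x) => // i iL; rewrite sx ?sy ?sL.
have [Ax0|nAx0] := pselect (A x0).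
  have -> : A `&` cylinder s = cylinder s.
    by apply/setIidPr => y sy; exact: (sA x0).
  have -> : A `&` [set x | x L = n] `&` cylinder s = cylinder (rcons s n).
    rewrite cylinder_rcons sL; apply/seteqP; split=> [x [[_ xn] sx]//|x [sx xn]].
    by split=> //; split=> //; exact: (sA x0).
  exact: measure_cylinder_rcons.
have As0 : A `&` cylinder s = set0.
  by rewrite -subset0 => y [Ay sy]; apply: nAx0; exact: (sA y).
by rewrite setIAC As0 set0I measure0 mule0.
Qed.

Lemma measure_avoid (n : nat) (d : seq nat) : uniq d ->
  mu [set x : baire | forall i, i \in d -> x i <> n] =
    ((1 - 2^-1 ^+ n.+1) ^+ size d)%:E.
Proof.
move=> ud; set p := (2^-1 ^+ n.+1)%R.
(* Stated for the coordinates below [L] in [P], so that they are added in increasing order, each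
   independent of the earlier ones. *)
have avoid (P : pred nat) L :
    mu [set x : baire | forall i, (i < L)%N -> P i -> x i <> n] =
    ((1 - p) ^+ count P (iota 0 L))%:E.
  elim: L => [|L IH].
    rewrite [X in mu X](_ : _ = setT) ?measure_setT_baire ?expr0//.
    by apply/seteqP; split.
  set A := [set x : baire | _] in IH.
  have Adet (x y : baire) : A x -> (forall i, (i < L)%N -> y i = x i) -> A y.
    by move=> Ax yx i iL Pi; rewrite yx//; exact: Ax.
  have oA : open A.
    apply/open_cylinderP => x Ax; exists L => y /cylinder_mkseq.
    exact: Adet.
  have mA := measurable_open_baire oA.
  have mn : measurable ([set x : baire | x L = n] : set borel_baire).
    by apply: measurable_open_baire; exact: (open_coord L [set n]).
  rewrite -[in iota _ _]addn1 iotaD count_cat /= add0n addn0.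
  have [PL|nPL] := boolP (P L); last first.
    rewrite addn0 -IH; congr (mu _); apply/seteqP; split=> x Ax i iL Pi.
      by apply: Ax => //; exact: ltnW.
    move: iL; rewrite ltnS leq_eqVlt => /predU1P[iL|/Ax]; last exact.
    by rewrite iL (negbTE nPL) in Pi.
  rewrite [X in mu X](_ : _ = A `\` [set x | x L = n]).
    transitivity (mu A - mu (A `&` [set x | x L = n])).
      by apply: measureD => //; apply: (le_lt_trans (y := mu A)) => //; rewrite IH ltry.
    rewrite [X in _ - X]measure_coord_indep// IH -EFinM -EFinB.
    by rewrite exprD expr1 mulrBr mulr1 (mulrC p).
  apply/seteqP; split=> [x Ax|x [Ax xL] i].
    by split; [move=> i iL; apply: Ax; exact: ltnW|exact: Ax].
  by rewrite ltnS leq_eqVlt => /predU1P[->//|]; exact: Ax.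
have dmax i : i \in d -> (i < (\max_(j <- d) j).+1)%N.
  by move=> id; rewrite ltnS; exact: leq_bigmax_seq.
rewrite [X in mu X](_ : _ = [set x : baire |
    forall i, (i < (\max_(j <- d) j).+1)%N -> i \in d -> x i <> n]); last first.
  by apply/seteqP; split=> x dx i; [move=> _|move=> id]; apply: dx => //; exact: dmax.
rewrite avoid; congr ((_ ^+ _)%:E).
rewrite -size_filter; apply/perm_size/uniq_perm => //.
  by rewrite filter_uniq// iota_uniq.
move=> i; rewrite mem_filter mem_iota /= add0n andb_idr//.
exact: dmax.
Qed.

End lebesgue_measure_baire.

(** * Inner regularity *)

Section regularity.
Context {R : realType} (mu : {measure set borel_baire -> \bar R})
  (hmu : lebesgue_baire mu).
Local Open Scope ereal_scope.

Lemma measure_baire_lty (A : set borel_baire) : measurable A -> mu A < +oo.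
Proof.
move=> mA; apply: (@le_lt_trans _ _ (mu setT)).
  by apply: le_measure; rewrite ?inE.
by rewrite (measure_setT_baire hmu) ltry.
Qed.

Definition inner_closed (A : set borel_baire) : Prop :=
  forall e : R, (0 < e)%R ->
    exists K : set baire, [/\ closed K, K `<=` A & mu (A `\` K) <= e%:E].

Lemma inner_closed_id (A : set baire) : closed A -> inner_closed A.
Proof.
move=> cA e e0; exists A; split=> //.
by rewrite setDv measure0 lee_fin ltW.
Qed.

Lemma inner_closed_seq (F : (set borel_baire)^nat) (e : R) :
  (0 < e)%R -> (forall n, inner_closed (F n)) ->
  exists K : (set baire)^nat, [/\ forall n, closed (K n),
    forall n, K n `<=` F n &
    \sum_(n <oo) mu (F n `\` K n) <= e%:E].
Proof.
move=> e0 Fin.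
(* The [n]-th set gets the error share $e/2^{n+1}$. *)
have en (n : nat) : (0 < e / (2 ^ n.+1)%:R)%R by rewrite divr_gt0// ltr0n expn_gt0.
have /choice[K KP] := fun n => Fin n _ (en n).
exists K; split=> [n|n|]; [by have [] := KP n|by have [] := KP n|].
apply: le_trans (epsilon_trick0 xpredT (ltW e0)).
apply: lee_nneseries => [n _ _|n _]; first exact: measure_ge0.
by have [] := KP n.
Qed.

Lemma inner_closed_bigcap (F : (set borel_baire)^nat) :
  (forall n, measurable (F n)) -> (forall n, inner_closed (F n)) ->
  inner_closed (\bigcap_n F n).
Proof.
move=> mF Fin e e0; have [K [cK KF Ke]] := inner_closed_seq e0 Fin.
exists (\bigcap_n K n); split.
- by apply: closed_bigI => n _; exact: cK.
- by move=> x Kx n _; apply: KF; exact: Kx.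
apply: le_trans Ke; apply: measure_sigma_subadditive => //.
- by move=> n; apply: measurableD => //; exact: measurable_closed_baire.
- apply: measurableD; first exact: bigcap_measurable.
  by apply: measurable_closed_baire; apply: closed_bigI => n _; exact: cK.
move=> x [Fx /existsNP[n /not_implyP[_ nKx]]].
by exists n => //; split=> //; exact: Fx.
Qed.

(** The union of all [K n] need not be closed. Half of [e] pays for passing to the [K n], the rest
    for keeping only finitely many of them, by continuity from above. *)
Lemma inner_closed_bigcup (F : (set borel_baire)^nat) :
  (forall n, measurable (F n)) -> (forall n, inner_closed (F n)) ->
  inner_closed (\bigcup_n F n).
Proof.
move=> mF Fin e e0.
have e20 : (0 < e / 2)%R by rewrite divr_gt0.
have [K [cK KF Ke]] := inner_closed_seq e20 Fin.
have mK n : measurable (K n : set borel_baire) by exact: measurable_closed_baire.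
pose U : set borel_baire := \bigcup_n F n.
have mU : measurable U by exact: bigcup_measurable.
pose B N : set borel_baire := U `\` \bigcup_(n in `I_N) K n.
have mB N : measurable (B N).
  by apply: measurableD => //; exact: bigcup_measurable.
have capB : \bigcap_N B N = U `\` \bigcup_n K n.
  apply/seteqP; split=> [x Bx|x [Ux nKx] N _].
    by split=> [|[n _ Knx]]; [have [] := Bx 0%N I|have [_] := Bx n.+1 I; apply; exists n => //=].
  by split=> // -[n _ Knx]; apply: nKx; exists n.
have mcapB : measurable (\bigcap_N B N) by exact: bigcap_measurable.
have capB_le : mu (\bigcap_N B N) <= (e / 2)%:E.
  apply: le_trans Ke; apply: measure_sigma_subadditive => //.
    by move=> n; exact: measurableD.
  rewrite capB => x [[n _ Fx] nKx]; exists n => //; split=> // Kx.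
  by apply: nKx; exists n.
have /= cvB : mu \o B @ \oo --> mu (\bigcap_N B N).
  apply: nonincreasing_cvg_mu => //; first exact: measure_baire_lty.
  move=> m n mn; apply/subsetPset => x [Ux nKx]; split=> // -[k /= km Kx].
  by apply: nKx; exists k => //=; exact: leq_trans mn.
have [N Ne] : exists N, mu (B N) <= e%:E.
  apply: contrapT => nN.
  have : e%:E <= mu (\bigcap_N B N).
    rewrite -(cvg_lim _ cvB)//; apply: lime_ge; first by apply/cvg_ex; eexists; exact: cvB.
    apply: nearW => N; rewrite leNgt; apply/negP => BN.
    by apply: nN; exists N; exact: ltW.
  move=> /le_trans /(_ capB_le); rewrite lee_fin.
  by rewrite leNgt ltr_pdivrMr// ltr_pMr// ltr1n.
exists (\bigcup_(n in `I_N) K n); split=> //.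
  by apply: closed_bigcup => //; exact: finite_II.
by move=> x [n _ /KF Fx]; exists n.
Qed.

(** The sets approximable from inside together with their complements form a sigma-algebra. It
    contains the open sets, which are countable unions of clopen cylinders. *)
Lemma inner_closed_measurable (A : set borel_baire) :
  measurable A -> inner_closed A.
Proof.
pose D := [set A : set borel_baire |
  [/\ measurable A, inner_closed A & inner_closed (~` A)]].
suff mD : measurable `<=` D by move=> /mD[].
apply: smallest_sub.
  split.
  - split=> //; first by apply: inner_closed_id; exact: closed0.
    by rewrite setC0; apply: inner_closed_id; exact: closedT.
  - move=> B [mB Bi BCi]; rewrite setTD; split=> //; last by rewrite setCK.
    exact: measurableC.
  move=> F FD; split.
  - by apply: bigcup_measurable => n _; have [] := FD n.
  - by apply: inner_closed_bigcup => n; have [] := FD n.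
  rewrite setC_bigcup; apply: inner_closed_bigcap => n; last by have [] := FD n.
  by apply: measurableC; have [] := FD n.
move=> U oU; split; first exact: measurable_open_baire.
  pose F k : set baire := if choice.pickle_inv k is Some s then
    if `[< cylinder s `<=` U >] then cylinder s else set0 else set0.
  have -> : U = \bigcup_k F k.
    apply/seteqP; split=> [x Ux|x [k _]].
      have [n xU] := (open_cylinderP U).1 oU x Ux.
      exists (choice.pickle (mkseq x n)) => //.
      by rewrite /F choice.pickleK_inv asboolT//; exact/cylinder_mkseq.
    by rewrite /F; case: choice.pickle_inv => // s; case: asboolP => // + sx; exact.
  have cF k : closed (F k).
    rewrite /F; case: choice.pickle_inv => [s|]; last exact: closed0.
    by case: asboolP => _; [exact: closed_cylinder|exact: closed0].
  apply: inner_closed_bigcup => k; last exact: inner_closed_id.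
  exact: measurable_closed_baire.
by apply: inner_closed_id; rewrite closedC.
Qed.

(** Approximate the complement of a Borel null cover of [N] from inside, losing at most half of the
    total mass 1. *)
Lemma closed_avoiding_null (N : set baire) : null_ideal mu N ->
  exists K : set baire, [/\ closed K, 0 < mu K & K `&` N = set0].
Proof.
move=> [M [mM M0 NM]].
have half0 : (0 < 2^-1 :> R)%R by rewrite invr_gt0.
have [K [cK KM Ke]] := inner_closed_measurable (measurableC mM) half0.
exists K; split=> //; last first.
  by rewrite -subset0 => x [/KM Mx /NM].
rewrite measure_gt0; apply/eqP => K0.
have mK := measurable_closed_baire cK.
have : mu setT <= (2^-1)%:E.
  apply: le_trans Ke; rewrite -[leRHS]adde0 -[X in _ <= _ + X]M0.
  rewrite -[X in _ <= _ + X]adde0 -[X in _ <= _ + (_ + X)]K0.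
  have TE : [set: borel_baire] `<=` (~` M `\` K) `|` (M `|` K).
    move=> x _; have [Kx|nKx] := pselect (K x); first by right; right.
    by have [Mx|nMx] := pselect (M x); [right; left|left].
  have mD : measurable (~` M `\` K) by apply: measurableD => //; exact: measurableC.
  apply: (@le_trans _ _ (mu ((~` M `\` K) `|` (M `|` K)))).
    apply: le_measure => //; rewrite inE//.
    by apply: measurableU => //; exact: measurableU.
  apply: (le_trans (measureU2 _ _ _)) => //; first exact: measurableU.
  by apply: leeD => //; exact: measureU2.
by rewrite (measure_setT_baire hmu) lee_fin leNgt invf_lt1 ?ltr1n.
Qed.

End regularity.

(** * Capturing few reals by a slalom *)

Lemma finite_small_seq (S : set nat) (w : nat) :
  (forall d, uniq d -> {subset d <= S} -> (size d <= w)%N) ->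
  exists t : seq nat, (size t <= w)%N /\ forall k, S k -> k \in t.
Proof.
move=> Sw; have [finS|infS] := pselect (finite_set S).
  exists (fset_set S); split=> [|k Sk]; last by rewrite in_fset_set// inE.
  by apply: Sw; [exact: fset_uniq|move=> k; rewrite in_fset_set].
have [d dS wd] := infinite_set_fset w.+1 infS.
have := Sw d (fset_uniq _); rewrite leqNgt wd => /(_ _)/negP; case=> // k kd.
by rewrite inE; exact: dS.
Qed.

(** By [measure_avoid], the bound says that avoiding the value [n] at [w] distinct coordinates has
    probability at most $2^{-n}$. *)
Lemma geometric_width (R : realType) (n : nat) :
  exists w, (1 - 2^-1 ^+ n.+1 : R) ^+ w <= 2^-1 ^+ n.
Proof.
have p0 : 0 < 2^-1 ^+ n.+1 :> R by rewrite exprn_gt0// invr_gt0.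
have p1 : 2^-1 ^+ n.+1 <= 1 :> R.
  by rewrite exprn_ile1// ?invr_ge0// invf_le1// ler1n.
have z1 : `|1 - 2^-1 ^+ n.+1 : R| < 1.
  by rewrite ger0_norm ?subr_ge0// ltrBlDr ltrDl.
have q0 : 0 < 2^-1 ^+ n :> R by rewrite exprn_gt0// invr_gt0.
have [w _ /(_ w (leqnn w)) /=] : \forall w \near \oo,
    `|(1 - 2^-1 ^+ n.+1 : R) ^+ w| <= 2^-1 ^+ n.
  exact: (@cvgr0_norm_le R R^o _ _ _ _ (cvg_expr z1) _ q0).
by move=> /(le_trans (ler_norm _)) ww; exists w.
Qed.

(** Distinct pairs use distinct coordinates, so these events are independent; their probability
    $2^{-(n+1)}$ does not depend on [k] and is summable in [n]. *)
Definition spike (n k : nat) : set baire :=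
  [set x : baire | x (choice.pickle (n, k)) = n].

Section capture.
Context {R : realType} (mu : {measure set borel_baire -> \bar R})
  (hmu : lebesgue_baire mu).
Local Open Scope ereal_scope.

Lemma measurable_spike (n k : nat) : measurable (spike n k : set borel_baire).
Proof. by apply: measurable_open_baire; exact: (open_coord _ [set n]). Qed.

Lemma measure_spike (n k : nat) : mu (spike n k) = (2^-1 ^+ n.+1)%:E.
Proof.
have := @measure_coord_indep _ _ hmu (choice.pickle (n, k)) n setT.
by rewrite setTI measure_setT_baire// mule1; apply.
Qed.

(** Borel-Cantelli: the measures of the spikes have sum at most 1. *)
Lemma lim_sup_spike_null (f : baire) :
  null_ideal mu (lim_sup_set (fun n => spike n (f n))).
Proof.
have ms n : measurable (spike n (f n) : set borel_baire).
  exact: measurable_spike.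
have mlim : measurable (lim_sup_set (fun n => spike n (f n)) : set borel_baire).
  apply: bigcap_measurable; first by exists 0%N.
  by move=> n _; exact: bigcup_measurable.
apply/(negligibleP _ mlim); apply: lim_sup_set_cvg0 => //.
apply: le_lt_trans (ltry 1%R).
apply: le_trans (epsilon_trick0 xpredT (@ler01 R)).
apply: lee_nneseries => [n _ _|n _]; first exact: measure_ge0.
by rewrite [leLHS]measure_spike lee_fin exprVn div1r natrX.
Qed.

Definition null_trace (K : set baire) (s : seq nat) (n : nat) : set nat :=
  [set k | mu (K `&` cylinder s `&` spike n k) = 0].

(* Baire's argument inside K, with "meets K" replaced by "meets K in positive
   measure". *)
Lemma null_trace_capture (K : set baire) (f : baire) : closed K -> 0 < mu K ->
  K `&` lim_sup_set (fun n => spike n (f n)) = set0 ->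
  exists s, 0 < mu (K `&` cylinder s) /\
    \forall n \near \oo, null_trace K s n (f n).
Proof.
move=> cK K0 Kf; apply: contrapT => ns.
have mK := measurable_closed_baire cK.
have mKs s : measurable (K `&` cylinder s : set borel_baire).
  by apply: measurableI => //; exact: measurable_cylinder.
pose G := [set s | 0 < mu (K `&` cylinder s)].
pose Q m := [set s | exists2 n, (m <= n)%N & cylinder s `<=` spike n (f n)].
have [|m s Gs|x _ xP] := @generic_branch G Q [::].
- by rewrite /G /= cylinder_nil setIT.
- have [n mn Kn] : exists2 n, (m <= n)%N & ~ null_trace K s n (f n).
    apply: contrapT => nn; apply: ns; exists s; split=> //.
    exists m => // n /= mn; apply: contrapT => Kn; apply: nn; by exists n.
  (* Sequences of length [L] properly extend [s] and also decide the coordinate [c] of the spike. *)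
  pose c := choice.pickle (n, f n); pose L := (maxn (size s) c).+1.
  have mKsn := measurableI _ _ (mKs s) (measurable_spike n (f n)).
  have [t tL Kt] : exists2 t, size t = L &
      mu (K `&` cylinder s `&` spike n (f n) `&` cylinder t) != 0.
    apply: contrapT => nt; apply: Kn; apply: (@measure_level0 R mu L _ mKsn) => t tL.
    by apply: contrapT => /eqP Kt; apply: nt; exists t.
  have [x [[[Kx sx] nx] tx]] :
      K `&` cylinder s `&` spike n (f n) `&` cylinder t !=set0.
    by apply/set0P; apply: contraNneq Kt => ->; rewrite measure0.
  have sL : (size s < L)%N by rewrite ltnS leq_maxl.
  have tE : t = s ++ drop (size s) t.
    rewrite -[LHS](cat_take_drop (size s)); congr (_ ++ _).
    apply: (@eq_from_nth _ 0%N) => [|i].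
      by rewrite size_take tL sL.
    rewrite size_take tL sL => si.
    by rewrite nth_take// -tx ?sx// tL (ltn_trans si).
  exists (drop (size s) t); rewrite -tE; split.
  + by rewrite -size_eq0 size_drop tL subn_eq0 -ltnNge.
  + rewrite /G /= measure_gt0; apply: contraNneq Kt => Kt0.
    apply/eqP; apply: subset_measure0 Kt0.
    * by apply: measurableI => //; exact: measurable_cylinder.
    * exact: mKs.
    * by move=> y [[[]]].
  + exists n => // y ty; rewrite /spike /= -/c.
    have cL : (c < L)%N by rewrite ltnS leq_maxr.
    by rewrite ty ?tL// -tx ?tL//.
(* The branch lies in [K], because [K] is closed and meets all its cylinders, and in the limit
   superior, because every [Q m] was met. *)
have : (K `&` lim_sup_set (fun n => spike n (f n))) x; last by rewrite Kf.
split.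
  rewrite (closure_id K).1// => U /nbhs_cylinder[k kU].
  have [m [km Gm _]] := xP k.
  have [y [Ky my]] : K `&` cylinder (mkseq x m) !=set0.
    apply/set0P; apply: contraTneq Gm => K0'.
    by rewrite /G /= K0' measure0 ltxx.
  exists y; split=> //; apply: kU; apply/cylinder_mkseq => i ik.
  by move/cylinder_mkseq: my => ->//; exact: leq_trans km.
move=> m _; have [j [_ _ [n mn jn]]] := xP m.
by exists n => //; apply: jn; exact/cylinder_mkseq.
Qed.

(** Up to a null set, [K] within the cylinder avoids the value [n] at [size d] distinct coordinates,
    and these are independent. *)
Lemma null_trace_size (K : set baire) (s d : seq nat) (n : nat) :
  closed K -> uniq d -> {subset d <= null_trace K s n} ->
  mu (K `&` cylinder s) <= ((1 - 2^-1 ^+ n.+1) ^+ size d)%:E.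
Proof.
move=> cK ud dK.
pose A : set borel_baire := K `&` cylinder s.
have mA : measurable A.
  by apply: measurableI; apply: measurable_closed_baire => //; exact: closed_cylinder.
pose c (k : nat) := choice.pickle (n, k).
have cinj : injective c by move=> j k /(pcan_inj choice.pickleK)[].
rewrite -(size_map c) -(measure_avoid hmu); last by rewrite map_inj_uniq.
set V := [set x : baire | _].
have mV : measurable (V : set borel_baire).
  have -> : V = \bigcap_(k in [set` d]) ~` spike n k.
    apply/seteqP; split=> x Vx.
      by move=> k kd; apply: Vx; exact: map_f.
    by move=> _ /mapP[k kd ->]; exact: Vx.
  apply: fin_bigcap_measurable; first exact: finite_seq.
  by move=> k _; apply: measurableC; exact: measurable_spike.
have AV0 : mu (A `\` V) = 0.
  have mAs k : measurable (A `&` spike n k).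
    by apply: measurableI => //; exact: measurable_spike.
  have mU : measurable (\bigcup_(k in [set` d]) (A `&` spike n k)).
    by apply: fin_bigcup_measurable => //; exact: finite_seq.
  apply: (subset_measure0 (measurableD mA mV) mU).
    move=> x [Ax /existsNP[_ /not_implyP[/mapP[k kd ->] /contrapT xk]]].
    by exists k.
  apply/(negligibleP _ mU).
  rewrite bigcup_mkcond; apply: negligible_bigcup => k.
  case: ifPn => [/set_mem/= kd|_]; last exact: negligible_set0.
  by apply/(negligibleP _ (mAs k)); have := dK k kd; rewrite inE.
have AE : mu A = mu (A `\` V) + mu (A `&` V) := measureDI _ mA mV.
rewrite [leLHS]AE AV0 add0e.
by apply: le_measure; rewrite ?inE//; exact: measurableI.
Qed.

(** More than [w n] elements in the trace would force the fixed positive measure of [K] within the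
    cylinder to be at most $2^{-n}$, which fails for large [n]. *)
Lemma null_trace_width (w : nat -> nat) (K : set baire) (s : seq nat) :
  (forall n, (1 - 2^-1 ^+ n.+1 : R) ^+ w n <= 2^-1 ^+ n)%R ->
  closed K -> 0 < mu (K `&` cylinder s) ->
  \forall n \near \oo, exists t : seq nat,
    (size t <= w n)%N /\ forall k, null_trace K s n k -> k \in t.
Proof.
move=> wP cK Ks0.
have [e e0 eK] : exists2 e : R, (0 < e)%R & e%:E <= mu (K `&` cylinder s).
  have mKs : measurable (K `&` cylinder s : set borel_baire).
    by apply: measurableI; [exact: measurable_closed_baire|exact: measurable_cylinder].
  have fKs : mu (K `&` cylinder s) \is a fin_num.
    by rewrite ge0_fin_numE// (measure_baire_lty hmu).
  exists (fine (mu (K `&` cylinder s))); last by rewrite fineK.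
  by rewrite fine_gt0// Ks0 -ge0_fin_numE.
have h1 : (`|2^-1 : R| < 1)%R by rewrite ger0_norm ?invr_ge0// invf_lt1 ?ltr1n.
have e20 : (0 < e / 2)%R by rewrite divr_gt0.
have [N _ NE] := @cvgr0_norm_le R R^o _ _ _ _ (cvg_expr h1) _ e20.
exists N => // n /NE /= nE; apply: finite_small_seq => d ud dK.
rewrite leqNgt; apply/negP => wd.
have := le_trans eK (null_trace_size cK ud dK); rewrite lee_fin.
apply/negP; rewrite -ltNge.
have p0 : (0 < 2^-1 ^+ n.+1 :> R)%R by rewrite exprn_gt0// invr_gt0.
have p1 : (2^-1 ^+ n.+1 <= 1 :> R)%R.
  by rewrite exprn_ile1// ?invr_ge0// invf_le1// ler1n.
apply: (@le_lt_trans _ _ (e / 2)%R); last first.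
  by rewrite ltr_pdivrMr// ltr_pMr// ltr1n.
apply: le_trans (le_trans (ler_norm _) nE); apply: le_trans (wP n).
by apply: ler_wiXn2l; rewrite ?subr_ge0 ?gerBl ?(ltW p0) ?(ltnW wd).
Qed.

Context (hadd : add_card (null_ideal mu) #= continuum).

Lemma null_ideal_small_bigcup (F : set (set baire)) :
  small F -> F `<=` null_ideal mu -> null_ideal mu (\bigcup_(A in F) A).
Proof.
move=> sF FN; apply: contrapT => nF; apply: sF.
have PF : [set F : set (set baire) |
    F `<=` null_ideal mu /\ ~ null_ideal mu (\bigcup_(A in F) A)] F by split.
have [_ /(_ _ PF)] := @least_cardP _ _ (ex_intro _ F PF).
by rewrite (card_le_eql hadd).
Qed.

(** One [K] serves all of [F]. [S n] collects the traces at [n] for the sequences with code below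
    [n], at most [w n] values each; the sequence that captures [f] takes part once [n] exceeds its
    code. *)
Lemma capture_width (w : nat -> nat) (F : set baire) :
  (forall n, (1 - 2^-1 ^+ n.+1 : R) ^+ w n <= 2^-1 ^+ n)%R -> small F ->
  exists S : nat -> seq nat, (forall n, (size (S n) <= n * w n)%N) /\
    forall f, F f -> \forall n \near \oo, f n \in S n.
Proof.
move=> wP sF.
pose H (f : baire) : set baire := lim_sup_set (fun n => spike n (f n)).
have NH : null_ideal mu (\bigcup_(A in H @` F) A).
  apply: null_ideal_small_bigcup; first exact: small_image.
  by move=> _ [f Ff <-]; exact: lim_sup_spike_null.
have [K [cK K0 KH]] := closed_avoiding_null hmu NH.
(* The list is empty if [j] codes no sequence or the trace does not fit into [w n] values. *)
have /choice[T TP] : forall jn : nat * nat, exists t : seq nat,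
    (size t <= w jn.2)%N /\ forall s, choice.pickle_inv jn.1 = Some s ->
    (exists t', (size t' <= w jn.2)%N /\
       forall k, null_trace K s jn.2 k -> k \in t') ->
    forall k, null_trace K s jn.2 k -> k \in t.
  move=> [j n] /=; case: choice.pickle_inv => [s|]; last by exists [::].
  have [[t tP]|nt] := pselect (exists t : seq nat, (size t <= w n)%N /\
       forall k, null_trace K s n k -> k \in t).
    by exists t; split=> [|_ [<-] _]; have [] := tP.
  by exists [::]; split=> // _ [<-] /nt.
exists (fun n => flatten [seq T (j, n) | j <- index_iota 0 n]); split=> [n|f Ff].
  rewrite size_flatten /shape -map_comp sumnE big_map.
  rewrite -[X in (_ <= X * _)%N]subn0 -sum_nat_const_nat.
  by apply: leq_sum => j _; have [] := TP (j, n).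
have [|s [s0 sf]] := @null_trace_capture K f cK K0.
  by rewrite -subset0 -KH => x [Kx fx]; split=> //; exists (H f) => //; exists f.
have sw := null_trace_width wP cK s0.
pose j := choice.pickle s.
near=> n.
apply/flatten_mapP; exists j; first by rewrite mem_index_iota; near: n; exists j.+1.
have [_ /(_ s _)] := TP (j, n); apply=> /=; first exact: choice.pickleK_inv.
  by near: n.
by near: n.
Unshelve. all: by end_near. Qed.

(** Singletons are null, since the cylinders around a point have measure at most $2^{-n}$, and [D]
    is a union of fewer than continuum many of them. *)
Lemma null_ideal_small (D : set baire) : small D -> null_ideal mu D.
Proof.
move=> sD; have -> : D = \bigcup_(A in set1 @` D) A.
  apply/seteqP; split=> [x Dx|_ [_ [x Dx <-] ->//]].
  by exists [set x] => //; exists x.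
apply: null_ideal_small_bigcup; first exact: small_image.
move=> _ [x _ <-].
have xE : [set x] = \bigcap_n cylinder (mkseq x n).
  apply/seteqP; split=> [_ -> n _|y xy]; first exact/cylinder_mkseq.
  apply/funext => i; have /cylinder_mkseq := xy i.+1 I.
  exact.
have mx : measurable ([set x] : set borel_baire).
  rewrite xE; apply: bigcap_measurable; first by exists 0%N.
  by move=> n _; exact: measurable_cylinder.
apply/(negligibleP _ mx)/eqP; rewrite eq_le measure_ge0 andbT.
apply/lee_addgt0Pr => e e0; rewrite add0e.
have h1 : (`|2^-1 : R| < 1)%R by rewrite ger0_norm ?invr_ge0// invf_lt1 ?ltr1n.
have [n _ /(_ n (leqnn n)) /= ne] := @cvgr0_norm_le R R^o _ _ _ _ (cvg_expr h1) _ e0.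
apply: (@le_trans _ _ (mu (cylinder (mkseq x n)))).
  apply: le_measure; rewrite ?inE//; first exact: measurable_cylinder.
  by move=> _ ->; exact/cylinder_mkseq.
rewrite hmu lee_fin size_mkseq; apply: le_trans (le_trans (ler_norm _) ne).
have -> : (2^-1 ^+ n = \prod_(i < n) 2^-1 :> R)%R.
  by rewrite prodr_const card_ord.
apply: ler_prod => i _; rewrite exprn_ge0 ?invr_ge0//=.
by rewrite exprS ler_piMr ?invr_ge0// exprn_ile1 ?invr_ge0// invf_le1 ?ler1n.
Qed.

Lemma null_ideal_setT : ~ null_ideal mu setT.
Proof.
move=> /(negligibleP _ measurableT); rewrite [LHS](measure_setT_baire hmu).
by move=> /eqP; rewrite onee_eq0.
Qed.

End capture.

(** * The three relations and the three ideals *)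

Section combinatorics.
Context {R : realType} (mu : {measure set borel_baire -> \bar R})
  (hmu : lebesgue_baire mu) (hadd : add_card (null_ideal mu) #= continuum).

(* [b k] is the block containing [k], blocks being chosen so late that capturing
   block [n] up to [w n] values is affordable at each of its points. *)
Lemma block_index (w : nat -> nat) : exists b : nat -> nat, forall k,
  (forall n, (n <= k)%N -> (w n <= k)%N -> (n <= b k)%N) /\
  ((0 < b k)%N -> (w (b k) <= k)%N).
Proof.
have bex k : exists bk,
    (forall n, (n <= k)%N -> (w n <= k)%N -> (n <= bk)%N) /\
    ((0 < bk)%N -> (w bk <= k)%N); last by have [b bP] := choice bex; exists b.
pose P (i : 'I_k.+1) := (i == ord0) || (w i <= k)%N.
have [|i Pi imax] := @arg_maxnP _ ord0 P (@nat_of_ord k.+1); first by rewrite /P eqxx.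
exists i; split=> [n nk wn|]; last by case/orP: Pi => // /eqP ->.
by apply: (imax (Ordinal (nk : (n < k.+1)%N))); rewrite /P /= wn orbT.
Qed.

Lemma capture_slalom (F : set baire) : small F ->
  exists s : slalom, forall f, F f -> in_star f s.
Proof.
move=> sF; have /choice[w0 w0P] := @geometric_width R.
pose w n := (n * w0 n)%N.
have [b bP] := block_index w.
(* [blk f n] codes [f] far enough to include every [k] with [b k = n]: beyond this length the index
   [n.+1] would be admissible. *)
pose blk (f : baire) : baire :=
  fun n => choice.pickle (mkseq f (maxn n.+1 (w n.+1))).
have [S [Sw SP]] := capture_width hmu hadd w0P (small_image (f := blk) sF).
pose value k v : nat := nth 0%N (odflt [::] (choice.unpickle v)) k.
(* [take k] makes the slalom bound immediate; where [f] is captured it drops nothing, as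
   [w (b k) <= k] there. *)
pose s k : {fset nat} := [fset x in take k (map (value k) (S (b k)))]%fset.
have sk k : (#|` s k| <= k)%N.
  rewrite /s card_fseq (leq_trans (size_undup _))// size_take.
  by case: ltnP => // /ltnW.
exists (exist _ s sk) => f Ff.
have [N _ SN] := SP _ (imageP blk Ff).
exists (maxn N.+1 (w N.+1)) => // k /=; rewrite geq_max => /andP[Nk wNk].
have [/(_ _ Nk wNk) Nb wb] := bP k.
have b0 : (0 < b k)%N by exact: leq_trans Nb.
rewrite /s !inE take_oversize; last first.
  by rewrite size_map (leq_trans (Sw _)) // wb.
apply/mapP; exists (blk f (b k)); first by apply: SN; exact: ltnW.
rewrite /value /blk choice.pickleK /= nth_mkseq// ltnNge geq_max.
apply/negP => /andP[bk wbk].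
by have [/(_ _ bk wbk)] := bP k; rewrite ltnn.
Qed.

Lemma le_star_bound (F : set baire) : small F ->
  exists z : baire, forall f, F f -> le_star f z.
Proof.
move=> /capture_slalom[s sP].
exists (fun n => \max_(i <- sval s n) i)%N => f /sP[N _ fN].
by exists N => // n /fN fn; exact: leq_bigmax_seq.
Qed.

(* With n values for f on n prescribed points, one can guess at least one of
   them by diagonalizing. *)
Lemma infinitely_equal (F : set baire) : small F ->
  exists z : baire, forall f, F f -> ~ ne_star z f.
Proof.
move=> sF; pose c (n j : nat) : nat := choice.pickle (n, j).
pose blk (f : baire) : baire := fun n => choice.pickle (mkseq (f \o c n) n).
have [[s sn] sP] := capture_slalom (small_image (f := blk) sF).
(* At the [j]-th point of block [n], [z] follows the [j]-th candidate in [s n]; if that candidate is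
   [blk f n], then [z] agrees with [f] there. *)
pose z : baire := fun k =>
  if choice.unpickle k is Some (n, j) then
    nth 0%N (odflt [::] (choice.unpickle (nth 0%N (s n) j))) j
  else 0%N.
exists z => f Ff [M _ zM].
have [N _ /= sN] := sP _ (imageP blk Ff).
pose j n := index (blk f (N + n)%N) (s (N + n)%N).
have zf n : z (c (N + n)%N (j n)) = f (c (N + n)%N (j n)).
  have bs : blk f (N + n)%N \in s (N + n)%N by apply: sN => /=; exact: leq_addr.
  have jn : (j n < N + n)%N.
    by apply: leq_trans (sn _); rewrite index_mem.
  rewrite /z /c choice.pickleK nth_index// choice.pickleK /=.
  by rewrite nth_mkseq.
(* The points of agreement lie in different blocks, so they are unbounded. *)
have [|n Mn] := @injective_gtn (fun n => c (N + n)%N (j n)) _ M.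
  by move=> m n /(pcan_inj choice.pickleK)[/addnI].
by apply: (zM (c (N + n)%N (j n))); [exact: ltnW|exact: zf].
Qed.

Lemma star_bound (r : rel_name) (F : set baire) : small F ->
  exists y : target r, forall f, F f -> star f y.
Proof.
case: r => sF; [exact: capture_slalom|exact: le_star_bound|].
have [z zP] := le_star_bound sF; exists (fun n => (z n).+1) => f /zP.
by apply: filterS => n fz fE; rewrite fE ltnn in fz.
Qed.

(** For slaloms and [le_star], exceed a common bound of the maxima or of the reals themselves; for
    [ne_star], evading means being equal infinitely often. *)
Lemma star_evade (r : rel_name) (Y : set (target r)) : small Y ->
  exists x : baire, forall y, Y y -> ~ star x y.
Proof.
case: r Y => /= Y sY; last exact: infinitely_equal.
  pose top (s : slalom) : baire := fun n => (\max_(i <- sval s n) i)%N.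
  have [z zP] := le_star_bound (small_image (f := top) sY).
  exists (fun n => (z n).+1) => s Ys [N _ sN].
  have [M _ zM] := zP _ (imageP top Ys).
  have /= zs := sN (maxn N M) (leq_maxl _ _).
  have := zM (maxn N M) (leq_maxr _ _).
  rewrite leqNgt => /negP; apply; rewrite /top.
  exact: (@leq_bigmax_seq _ _ xpredT id _ zs).
have [z zP] := le_star_bound sY.
exists (fun n => (z n).+1) => y /zP[M _ zM] [N _ yN].
have := zM (maxn N M) (leq_maxr _ _).
by have /= := yN (maxn N M) (leq_maxl _ _); move=> /leq_trans/[apply]; rewrite ltnn.
Qed.

(** Raising a common [le_star] bound to at least [n] everywhere absorbs the finitely many exceptions
    of a given real once [n] is large. *)
Lemma small_sigma_bounded (D : set baire) : small D ->
  exists z : nat -> baire,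
    D `<=` \bigcup_n [set x : baire | forall i, (x i <= z n i)%N].
Proof.
move=> /le_star_bound[z zP].
exists (fun n i => maxn (z i) n) => x /zP[N _ xz].
exists (\max_(i < N) x i)%N => // i /=; rewrite leq_max.
have [/xz -> //|iN] := leqP N i.
by rewrite (leq_bigmax (Ordinal iN)) orbT.
Qed.

Lemma ideal_small (i : ideal_name) (D : set baire) : small D -> ideal mu i D.
Proof.
case: i => sD; first exact: null_ideal_small.
  have [z zP] := small_sigma_bounded sD.
  (* [meager_ideal] asks for equality with the union, hence the intersection with [D]. *)
  exists (fun n => D `&` [set x : baire | forall i, (x i <= z n i)%N]).
    move=> n; rewrite /nowhere_dense -subset0 -(le_nowhere_dense (z n)).
    by apply: interiorS; apply: closureS; exact: subIsetr.
  by rewrite -setI_bigcupr; apply/esym/setIidPl.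
have [z zP] := small_sigma_bounded sD.
by exists (fun n => [set x : baire | forall i, (x i <= z n i)%N]) => // n;
  exact: le_compact.
Qed.

Lemma idealU (i : ideal_name) (A B : set baire) :
  ideal mu i A -> ideal mu i B -> ideal mu i (A `|` B).
Proof.
have interleave (F G : (set baire)^nat) : \bigcup_n F n `|` \bigcup_n G n =
    \bigcup_n (if odd n then F n./2 else G n./2).
  apply/seteqP; split=> [x [[n _ Fx]|[n _ Gx]]|x [n _]].
  - by exists n.*2.+1 => //=; rewrite odd_double /= uphalf_double.
  - by exists n.*2 => //=; rewrite odd_double doubleK.
  - by case: ifP => _ ?; [left|right]; exists n./2.
case: i; first exact: negligibleU.
  move=> [F Fnd ->] [G Gnd ->]; rewrite interleave.
  exists (fun n => if odd n then F n./2 else G n./2) => // n.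
  by case: ifP.
move=> [F Fc AF] [G Gc BG].
exists (fun n => if odd n then F n./2 else G n./2).
  by move=> n; case: ifP.
by rewrite -interleave; exact: setUSS.
Qed.

Lemma ideal_setT (i : ideal_name) : ~ ideal mu i setT.
Proof.
case: i; [exact: null_ideal_setT|exact: baire_not_meager|].
move=> [K cK TK].
(* Diagonalize: exceeding at coordinate [n] the bound for [K n] leaves every [K n]. *)
have /choice[z zP] : forall n, exists N, forall x, K n x -> (x n <= N)%N.
  by move=> n; exact: compact_coord_bounded.
have [n _ /zP] := TK (fun n => (z n).+1) I.
by rewrite ltnn.
Qed.

End combinatorics.

(** * Transfinite diagonalization for the two cardinals *)

Lemma small_set1 (T : Type) (a : T) : small [set a].
Proof.
rewrite /small (card_le_eqr (eq_card1 a 0%N)) => /card_le_set_inj[f fa finj].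
have fE X : f X = 0%N by exact: fa.
have := finj set0 setT; rewrite !inE !fE => /(_ I I erefl).
by move=> eqT; have : @set0 nat 0%N by rewrite eqT.
Qed.

Theorem theorem1p2 (R : realType) (mu : {measure set borel_baire -> \bar R})
    (hmu : lebesgue_baire mu)
    (hadd : add_card (null_ideal mu) #= continuum) :
  forall (i : ideal_name) (r : rel_name),
    succ_card continuum #<= b_card (@star r) (ideal mu i) /\
    succ_card continuum #<= d_card (@star r) (ideal mu i).
Proof.
move=> i r.
have evade Y := @star_evade R mu hmu hadd r Y.
have bound F := @star_bound R mu hmu hadd r F.
have Ismall D := @ideal_small R mu hmu hadd i D.
have IT := @ideal_setT R mu hmu i.
split; apply: succ_continuum_le => le_c.
- have [|bP _] := @least_cardP _ [set A : set (baire -> baire) |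
    ~ exists g : baire -> target r, forall f, A f -> rel_mod (@star r) (ideal mu i) f g].
    (* [b_card] is not the default value: an [f] evading [g x] at every [x] would put the whole
       space into the ideal. *)
    exists setT => -[g gP].
    have /choice[f fP] : forall x, exists v, ~ star v (g x).
      by move=> x; have [v /(_ _ erefl)] := evade _ (@small_set1 _ (g x)); exists v.
    apply: IT; suff <- : [set x | ~ star (f x) (g x)] = setT by exact: gP.
    by apply/seteqP; split=> // x _; exact: fP.
  have [W [Wx Wf]] := small_sections baire_le_continuum le_c.
  apply: bP.
  (* Fewer than continuum many [f] come before [x], so one value bounds all their values [f x]. *)
  have /choice[g gP] : forall x, exists y : target r, forall f,
      b_card (@star r) (ideal mu i) f -> W x f -> star (f x) y.
    move=> x; have [y yP] := bound _ (small_image (f := fun f => f x) (Wx x)).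
    by exists y => f Bf Wxf; apply: yP; exists f.
  exists g => f Bf; apply: Ismall; apply: small_sub (Wf f) => x nfg.
  by split=> // Wxf; apply: nfg; exact: gP.
have [|dP _] := @least_cardP _ [set A : set (baire -> target r) |
    forall g : baire -> baire, exists2 f, A f & rel_mod (@star r) (ideal mu i) g f].
  exists setT => g.
  have /choice[f fP] : forall x, exists y : target r, star (g x) y.
    by move=> x; have [y /(_ _ erefl)] := bound _ (@small_set1 _ (g x)); exists y.
  exists f => //; apply: Ismall; apply: small_sub (@small_set1 _ (g point)) => x.
  by move=> /(_ (fP x)).
have [W [Wx Wf]] := small_sections baire_le_continuum le_c.
have /choice[g gP] : forall x, exists v : baire, forall f,
    d_card (@star r) (ideal mu i) f -> W x f -> ~ star v (f x).
  move=> x; have [v vP] := evade _ (small_image (f := fun f => f x) (Wx x)).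
  by exists v => f Df Wxf; apply: vP; exists f.
have [f Df gf] := dP g.
(* Where [f x] does capture [g x], [f] does not come before [x], which happens for few [x]; both
   pieces of the space would be in the ideal. *)
apply: IT; rewrite -(setvU [set x | ~ star (g x) (f x)]).
apply: idealU => //; apply: Ismall; apply: small_sub (Wf f) => x /= /contrapT sgf.
by split=> // Wxf; exact: gP Wxf sgf.
Qed.
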